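(* Let $X$ be an absolutely continuous real random variable with probability density function $f$, cumulative distribution function $F$, support $(a,b)$ with $-\infty\le a<b<\infty$, finite second moment, and reversed hazard rate $\phi$. Suppose $E[e^X\phi(X)]<\infty$ and $E\left[\frac{1}{e^X\phi(X)}\right]<\infty$. Then $$E\left[\frac{1}{e^X\phi(X)}\right]\ \ge\ \frac{1}{E[e^X\phi(X)]},$$ and equality holds if and only if there is a constant $\alpha>0$ such that $F(x)=\bigl(F_0(x)\bigr)^{\alpha}$ for all $x\in(-\infty,b]$, where $F_0$ is the truncated extreme value distribution function $F_0(x)=e^{-(e^{-x}-e^{-b})}$, $x\in(-\infty,b]$.
   Context: Saying that $X$ has support $(a,b)$ means that $a=\inf\{t:F(t)>0\}$, $b=\sup\{t:F(t)<1\}$, and $f(t)>0$ for almost every $t\in(a,b)$. The reversed hazard rate of $X$ is $\phi(t)=f(t)/F(t)$ for $t\in(a,b)$. *)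

(* Defs.v *)
From HB Require Import structures.
From mathcomp Require Import all_boot all_order all_algebra.
From mathcomp Require Import all_classical all_reals all_analysis.
Set Implicit Arguments.
Unset Strict Implicit.
Unset Printing Implicit Defensive.
Import Order.TTheory GRing.Theory Num.Theory.
Import numFieldNormedType.Exports.
Local Open Scope classical_set_scope.
Local Open Scope ring_scope.
Local Open Scope ereal_scope.

Definition has_density (d : measure_display) (T : measurableType d)
    (R : realType) (P : probability T R) (X : {RV P >-> R}) (f : R -> R) :=
  [/\ measurable_fun [set: R] f,
      (forall t : R, 0 <= f t)%R &
      forall A : set R, measurable A ->
        distribution P X A = \int[lebesgue_measure]_(t in A) (f t)%:E].

Definition has_support (d : measure_display) (T : measurableType d)
    (R : realType) (P : probability T R) (X : {RV P >-> R}) (f : R -> R)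
    (a b : \bar R) :=
  [/\ a = ereal_inf (EFin @` [set t : R | 0 < cdf X t]),
      b = ereal_sup (EFin @` [set t : R | cdf X t < 1]) &
      {ae lebesgue_measure, forall t : R, a < t%:E < b -> (0 < f t)%R}].

(* Only meaningful on the support (a, b), where F > 0; it is made total so that
   it can be composed with X, which lies in (a, b) almost surely. *)
Definition reversed_hazard_rate (d : measure_display) (T : measurableType d)
    (R : realType) (P : probability T R) (X : {RV P >-> R}) (f : R -> R)
    (t : R) : R := (f t / fine (cdf X t))%R.

Definition truncated_extreme_value_cdf (R : realType) (b x : R) : R :=
  expR (- (expR (- x) - expR (- b))).

(* Main.v *)
(* Put Y = e^X phi(X) and m = E[Y]. Since Y > 0 almost surely,
   0 <= E[(Y - m)^2 / Y] = m^2 E[1/Y] - m, which is the inequality, with equality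
   exactly when Y is almost surely a constant c, i.e. f(t) = c e^(-t) F(t) for
   almost every t in (a, b). As F is an integral of f, F is then C^1 on (a, b) and
   F(t) exp(c e^(-t)) has zero derivative, so F = F_0^c there because F(b) = 1;
   a finite a is excluded by F(a) = 0. Conversely F' = f almost everywhere by
   Lebesgue differentiation, so F = F_0^alpha gives Y = alpha almost surely. *)
Require Import Defs.
From HB Require Import structures.
From mathcomp Require Import all_boot all_order all_algebra.
From mathcomp Require Import ring lra.
From mathcomp Require Import all_classical all_reals all_analysis.
From mathcomp Require Import measurable_realfun.
Set Implicit Arguments.
Unset Strict Implicit.
Unset Printing Implicit Defensive.
Import Order.TTheory GRing.Theory Num.Theory.
Import numFieldNormedType.Exports.
Local Open Scope classical_set_scope.
Local Open Scope ring_scope.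
Local Open Scope ereal_scope.

(** * Harmonic against arithmetic mean of an almost surely positive variable *)

Lemma measurable_funV_ge0 (d : measure_display) (T : measurableType d)
    (R : realType) (Y : T -> R) :
  measurable_fun [set: T] Y -> (forall w, 0 <= Y w)%R ->
  measurable_fun [set: T] (fun w => (Y w)^-1)%R.
Proof.
(* Inverse and power -1 agree even where [Y] vanishes: both take the value 0 there. *)
move=> mY Y0; rewrite (_ : (fun w => _) = (fun w => Y w `^ (-1)))%R.
  exact: (measurableT_comp (measurable_powR _)).
by apply/funext => w; rewrite powR_inv1.
Qed.

Section harmonic_mean.
Context (d : measure_display) (T : measurableType d) (R : realType).
Context (P : probability T R) (Y : T -> R).
Hypotheses (mY : measurable_fun [set: T] Y) (Y_ge0 : forall w, (0 <= Y w)%R).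
Hypothesis Y_gt0 : {ae P, forall w, (0 < Y w)%R}.

(** A nonnegative function with zero integral vanishes almost everywhere; with almost sure
    positivity this would make the whole space negligible. *)
Lemma ae_gt0_integral_gt0 : 0 < \int[P]_w (Y w)%:E.
Proof.
rewrite lt0e integral_ge0 ?andbT; last by move=> w _; rewrite lee_fin.
apply/eqP => Y0.
have : ae_eq P setT (EFin \o Y) (cst 0).
  apply/ae_eq_integral_abs => //; first exact/measurable_EFinP.
  by under eq_integral do rewrite /= ger0_norm//.
move=> Y_eq0; suff /negligibleP : P.-negligible [set: T].
  move=> /(_ measurableT); rewrite [LHS]probability_setT => /eqP.
  by rewrite eqe oner_eq0.
rewrite -setC0; apply: filterS2 Y_gt0 Y_eq0 => w Yw /(_ I) /= [] Yw0.
by rewrite Yw0 ltxx in Yw.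
Qed.

Hypothesis Y_fin : \int[P]_w (Y w)%:E < +oo.
Hypothesis V_fin : \int[P]_w (Y w)^-1%:E < +oo.

Let m := fine (\int[P]_w (Y w)%:E).

Let mE : \int[P]_w (Y w)%:E = m%:E.
Proof. by rewrite fineK// ge0_fin_numE// ltW// ae_gt0_integral_gt0. Qed.

Let m_gt0 : (0 < m)%R.
Proof. by rewrite -lte_fin -mE ae_gt0_integral_gt0. Qed.

Let Z w := ((Y w - m) ^+ 2 / Y w)%R.

Let Z_ge0 w : (0 <= Z w)%R.
Proof. by rewrite /Z divr_ge0// sqr_ge0. Qed.

Let mV : measurable_fun [set: T] (fun w => (Y w)^-1)%R.
Proof. exact: measurable_funV_ge0. Qed.

Let mZ : measurable_fun [set: T] Z.
Proof. by apply: measurable_funM => //; apply/measurable_funX/measurable_funB. Qed.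

(* [(Y - m)^2 / Y = Y - 2 m + m^2 / Y] wherever [Y <> 0]. *)
Let integral_Z : \int[P]_w (Z w)%:E + (2 * m)%:E
  = m%:E + (m ^+ 2)%:E * \int[P]_w (Y w)^-1%:E.
Proof.
(* The cross term stays on the left so that every integrand is nonnegative: additivity then applies
   before the integral of [Z] is known to be finite. *)
transitivity (\int[P]_w ((Z w)%:E + (2 * m)%:E)).
  rewrite ge0_integralD//=; last 3 first.
  - by move=> w _; rewrite lee_fin.
  - exact/measurable_EFinP.
  - by move=> w _; rewrite lee_fin mulr_ge0// ltW.
  by rewrite integral_cst//= probability_setT mule1.
rewrite -mE -ge0_integralZl//=; last 3 first.
- exact/measurable_EFinP.
- by move=> w _; rewrite lee_fin invr_ge0.
- by rewrite lee_fin sqr_ge0.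
rewrite -ge0_integralD//=; last 4 first.
- by move=> w _; rewrite lee_fin.
- exact/measurable_EFinP.
- by move=> w _; rewrite -EFinM lee_fin mulr_ge0// ?sqr_ge0 ?invr_ge0.
- by apply/measurable_EFinP/measurable_funM.
apply: ge0_ae_eq_integral => //=.
- by apply/measurable_EFinP/measurable_funD.
- apply/measurable_EFinP; apply: measurable_funD => //; exact: measurable_funM.
- by move=> w _; rewrite -EFinD lee_fin addr_ge0// mulr_ge0// ltW.
- move=> w _; rewrite -EFinM -EFinD lee_fin addr_ge0// mulr_ge0 ?sqr_ge0//.
  by rewrite invr_ge0.
apply: filterS Y_gt0 => w Yw _; rewrite -EFinM -!EFinD /Z; congr EFin.
by field; rewrite gt_eqF.
Qed.

Let integral_Z_ge0 : 0 <= \int[P]_w (Z w)%:E.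
Proof. by apply: integral_ge0 => w _; rewrite lee_fin. Qed.

(** Dropping the nonnegative integral of [Z] from [integral_Z] leaves 2m <= m + m^2 E[1/Y]; cancel m
    and divide by m^2. *)
Lemma inv_integral_le : (\int[P]_w (Y w)%:E)^-1 <= \int[P]_w (Y w)^-1%:E.
Proof.
have V_ge0 : 0 <= \int[P]_w (Y w)^-1%:E.
  by apply: integral_ge0 => w _; rewrite lee_fin invr_ge0.
rewrite mE inver gt_eqF//.
have : m%:E <= (m ^+ 2)%:E * \int[P]_w (Y w)^-1%:E.
  have : (2 * m)%:E <= m%:E + (m ^+ 2)%:E * \int[P]_w (Y w)^-1%:E.
    by rewrite -integral_Z leeDr.
  rewrite -(@fineK _ (integral _ _ _)) ?ge0_fin_numE//.
  by rewrite -EFinM -EFinD !lee_fin; lra.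
rewrite -(@fineK _ (integral _ _ _)) ?ge0_fin_numE// -EFinM !lee_fin => h.
rewrite -(ler_pM2l m_gt0) -(ler_pM2l m_gt0) divff ?gt_eqF// mulr1.
by rewrite mulrA -expr2.
Qed.

Lemma inv_integral_eq_cst : \int[P]_w (Y w)^-1%:E = (\int[P]_w (Y w)%:E)^-1 ->
  exists2 c : R, (0 < c)%R & {ae P, forall w, Y w = c}.
Proof.
rewrite mE inver gt_eqF// => VE; exists m => //.
(* With E[1/Y] = 1/m the right side of [integral_Z] is 2m, which cancels the 2m on the left. *)
have Z0 : \int[P]_w (Z w)%:E = 0.
  move: integral_Z integral_Z_ge0; rewrite VE.
  case: (integral _ _ _) => [r||]//.
  rewrite -EFinM -!EFinD => -[] h _; congr EFin.
  have -> : r = (r + 2 * m - 2 * m)%R by lra.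
  by rewrite h expr2 mulfK ?gt_eqF//; lra.
have : ae_eq P setT (EFin \o Z) (cst 0).
  apply/ae_eq_integral_abs => //; first exact/measurable_EFinP.
  by under eq_integral do rewrite /= ger0_norm//.
move=> Z_eq0; apply: filterS2 Y_gt0 Z_eq0 => w Yw /(_ I) [] /eqP.
by rewrite mulf_eq0 invr_eq0 (gt_eqF Yw) orbF sqrf_eq0 subr_eq0 => /eqP.
Qed.

End harmonic_mean.

Lemma ae_cst_integral (d : measure_display) (T : measurableType d)
    (R : realType) (P : probability T R) (Y : T -> R) (c : R) :
  measurable_fun [set: T] Y -> {ae P, forall w, Y w = c} ->
  \int[P]_w (Y w)%:E = c%:E.
Proof.
move=> mY Yc; rewrite (ae_eq_integral (cst c%:E))//.
- by rewrite integral_cst//= probability_setT mule1.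
- exact/measurable_EFinP.
- by apply: filterS Yc => w -> _.
Qed.

(** * Regularity of the distribution function, and null sets seen through the density *)

Section density.
Context (d : measure_display) (T : measurableType d) (R : realType).
Context (P : probability T R) (X : {RV P >-> R}) (f : R -> R).
Hypothesis hf : has_density X f.

Local Notation mu := (@lebesgue_measure R).
Local Notation F t := (fine (cdf X t)).

Let mf : measurable_fun [set: R] f. Proof. by case: hf. Qed.

Let f_ge0 t : (0 <= f t)%R. Proof. by case: hf. Qed.

Let distributionE A : measurable A ->
  distribution P X A = \int[mu]_(t in A) (f t)%:E.
Proof. by case: hf => _ _; apply. Qed.

Lemma density_integrable (A : set R) :
  measurable A -> mu.-integrable A (EFin \o f).
Proof.
move=> mA; apply: (@integrableS _ _ _ _ setT) => //.
apply/integrableP; split; first exact/measurable_EFinP.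
under eq_integral do rewrite /= ger0_norm//.
by rewrite -distributionE// probability_setT ltry.
Qed.

Lemma fine_cdfK t : (fine (cdf X t))%:E = cdf X t.
Proof. by rewrite fineK// fin_num_measure. Qed.

Lemma fine_cdf_nondecreasing : {homo (fun t => F t) : s t / (s <= t)%R}.
Proof. by move=> s t st; rewrite fine_le ?fin_num_measure// cdf_nondecreasing. Qed.

Lemma fine_cdf_ge0 t : (0 <= F t)%R.
Proof. exact/fine_ge0/cdf_ge0. Qed.

Lemma fine_cdf_le1 t : (F t <= 1)%R.
Proof. by rewrite -lee_fin fine_cdfK cdf_le1. Qed.

Lemma fine_cdfE x : F x = (\int[mu]_(t in `]-oo, x]) f t)%R.
Proof. by rewrite /= /cdf distributionE. Qed.

Lemma fine_cdfB p x : (p <= x)%R ->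
  (F x - F p = \int[mu]_(t in `[p, x]) f t)%R.
Proof.
move=> px; rewrite !fine_cdfE Rintegral_itvB ?bnd_simp//; last first.
  exact: density_integrable.
by rewrite Rintegral_itv_obnd_cbnd//; exact: density_integrable.
Qed.

(** To the right of x - 1, [F] is the constant F(x - 1) plus the integral of [f] from x - 1, which
    is continuous in its upper limit. *)
Lemma fine_cdf_continuous : continuous (fun t => F t).
Proof.
move=> x.
have xx : (x - 1 < x + 1)%R by lra.
have := @parameterized_integral_continuous R _ _ f (ltW xx)
  (density_integrable (measurable_itv _)).
move=> /(continuous_within_itvP _ xx)[+ _ _] => /(_ x).
have xin : x \in `](x - 1)%R, (x + 1)%R[ by rewrite in_itv/=; apply/andP; lra.
move=> /(_ xin) cx.
pose G y := (F (x - 1) + parameterized_integral mu (x - 1) y f)%R.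
have GE y : (x - 1 <= y)%R -> G y = F y.
  by move=> xy; rewrite /G /parameterized_integral -fine_cdfB// addrC subrK.
have : {for x, continuous G} by apply: continuousD => //; exact: cst_continuous.
rewrite /prop_for /continuous_at GE; last by lra.
apply: cvg_trans; apply: near_eq_cvg; near=> y; rewrite GE//.
by apply/ltW; near: y; apply: lt_nbhsr; lra.
Unshelve. all: by end_near. Qed.

Lemma ae_is_derive_cdf : {ae mu, forall t : R, is_derive t (1 : R)%R (fun s => F s) (f t)}.
Proof.
have locf : locally_integrable [set: R] f.
  have := integrable_locally measurableT (density_integrable measurableT).
  by rewrite patch_setT.
have := FTC1Ny (fun y => density_integrable (measurable_itv `]-oo, y])) locf.
apply: (@filterS _ _ (ae_filter_ringOfSetsType mu)) => t [dF <-].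
rewrite (_ : (fun s => F s) = fun x => \int[mu]_(t in `]-oo, x]) f t)%R.
  by rewrite derive1E; exact/derivableP.
by apply/funext => x; exact: fine_cdfE.
Qed.

(** Reads off [f] wherever [F] coincides locally with an explicit function: the constants 0 and 1
    outside the support, a power of the extreme value function inside. *)
Lemma ae_density_eq_derive (g l : R -> R) :
  {ae mu, forall t : R, (\forall s \near t, F s = g s) ->
    is_derive t (1 : R)%R g (l t) -> f t = l t}.
Proof.
apply: (@filterS _ _ (ae_filter_ringOfSetsType mu)) ae_is_derive_cdf => t dF Fg dg.
rewrite -(@derive_val _ _ _ _ _ _ _ dF) -(@derive_val _ _ _ _ _ _ _ dg).
exact: near_eq_derive.
Qed.

(** The law of [X] charges neither Lebesgue null sets nor the zero set of [f]; [M] collects both. *)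
Lemma ae_comp_density (Q : R -> Prop) :
  {ae mu, forall t : R, (0 < f t)%R -> Q t} -> {ae P, forall w, Q (X w)}.
Proof.
move=> [N [mN N0 QN]].
pose M := N `|` [set t | f t = 0%R].
have mM0 : measurable [set t | f t = 0%R].
  rewrite (_ : mkset _ = setT `&` f @^-1` [set 0%R]); last by rewrite setTI.
  exact: mf.
have mM : measurable M by exact: measurableU.
exists (X @^-1` M); split.
- by rewrite -[X in measurable X]setTI; exact: measurable_funP.
- have NX : distribution P X N = 0.
    transitivity (\int[mu]_(t in N) (f t)%:E); first exact: distributionE.
    rewrite null_set_integral//.
    by apply/measurable_EFinP; exact: measurable_funTS.
  rewrite -[LHS]/(distribution P X M) /M setUC measureU0//.
  transitivity (\int[mu]_(t in [set t | f t = 0%R]) (f t)%:E).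
    exact: distributionE.
  by rewrite integral0_eq// => t /= ->.
- move=> w /= nQ; have [fX|fX] := eqVneq (f (X w)) 0%R; first by right.
  by left; apply: QN => /= h; apply/nQ/h; rewrite lt0r fX f_ge0.
Qed.

(** The set [A] where [g] differs from [c] has mass 0 under the law of [X], so [f] integrates to 0
    over it and vanishes almost everywhere on it. *)
Lemma ae_density_comp (g : R -> R) (c : R) : measurable_fun [set: R] g ->
  {ae P, forall w, g (X w) = c} ->
  {ae mu, forall t : R, (0 < f t)%R -> g t = c}.
Proof.
move=> mg gc.
pose A := ~` [set t | g t = c].
have mA : measurable A.
  apply: measurableC.
  rewrite (_ : mkset _ = setT `&` g @^-1` [set c]); last by rewrite setTI.
  exact: mg.
have mfA : measurable_fun A (EFin \o f).
  by apply/measurable_EFinP; exact: measurable_funTS.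
have : \int[mu]_(t in A) `|(EFin \o f) t| = 0.
  under eq_integral do rewrite /= ger0_norm//.
  rewrite -distributionE// -[LHS]/(P (X @^-1` A)).
  apply: (iffLR (negligibleP _ _)) => //.
  by rewrite -[X in measurable X]setTI; exact: measurable_funP.
move=> /ae_eq_integral_abs -/(_ mA mfA); apply: (@filterS _ _ (ae_filter_ringOfSetsType mu)) => t fA ft.
by apply: contrapT => /fA [] ft0; rewrite ft0 ltxx in ft.
Qed.

End density.

(** * Behaviour at the ends of the support, and the equation of constant hazard *)

Section reversed_hazard.
Context (d : measure_display) (T : measurableType d) (R : realType).
Context (P : probability T R) (X : {RV P >-> R}) (f : R -> R).
Context (a : \bar R) (b : R).
Hypotheses (hf : has_density X f) (hab : a < b%:E).
Hypothesis hsupp : has_support X f a b%:E.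

Local Notation mu := (@lebesgue_measure R).
Local Notation F t := (fine (cdf X t)).
Local Notation phi := (reversed_hazard_rate X f).
Local Notation aefilter := (ae_filter_ringOfSetsType mu).
Local Notation F0 := (truncated_extreme_value_cdf b).

Let ae_neq (c : R) : {ae mu, forall t : R, t <> c}.
Proof.
exists [set c]; split => //; first exact: lebesgue_measure_set1.
by move=> t /= /contrapT.
Qed.

(** If F(b) < 1, continuity gives some y > b with F(y) < 1, against [b] being the supremum of such
    points. *)
Lemma fine_cdf_right_support x : (b <= x)%R -> F x = 1%R.
Proof.
move=> bx; apply/eqP; rewrite eq_le fine_cdf_le1/=.
apply: le_trans (fine_cdf_nondecreasing X bx); rewrite leNgt; apply/negP => Fb.
have : \forall y \near b^'+, (F y < 1)%R.
  apply: cvgr_lt Fb; apply: cvg_at_right_filter.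
  exact: (fine_cdf_continuous hf).
move=> Fy; near b^'+ => y.
have : (y%:E <= b%:E).
  have [_ -> _] := hsupp; apply: ereal_sup_ubound; exists y => //=.
  by rewrite -fine_cdfK lte_fin; near: y.
rewrite lee_fin leNgt => /negP; apply.
by near: y; exact: nbhs_right_gt.
Unshelve. all: by end_near. Qed.

Lemma fine_cdf_left_support x : x%:E <= a -> F x = 0%R.
Proof.
move=> xa; apply/eqP; rewrite eq_le fine_cdf_ge0 andbT leNgt; apply/negP => Fx.
have : \forall y \near x^'-, (0 < F y)%R.
  apply: cvgr_gt Fx; apply: cvg_at_left_filter.
  exact: (fine_cdf_continuous hf).
move=> Fy; near x^'- => y.
have : a <= y%:E.
  have [-> _ _] := hsupp; apply: ereal_inf_lbound; exists y => //=.
  by rewrite -fine_cdfK lte_fin; near: y.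
move=> /(le_trans xa); rewrite lee_fin leNgt => /negP; apply.
by near: y; exact: nbhs_left_lt.
Unshelve. all: by end_near. Qed.

Lemma fine_cdf_gt0_support x : a < x%:E -> (0 < F x)%R.
Proof.
rewrite ltNge lt0r fine_cdf_ge0 andbT; apply: contra => /eqP Fx.
have [-> _ _] := hsupp; apply: le_ereal_inf_tmp => _ [y /= Fy <-].
rewrite lee_fin leNgt; apply/negP => yx.
by move: Fy; rewrite ltNge -fine_cdfK lee_fin -Fx fine_cdf_nondecreasing// ltW.
Qed.

(** Strictly outside the closed support [F] is locally constant, so its derivative, almost
    everywhere equal to [f], is 0; the endpoints form a null set. *)
Lemma ae_density_gt0_support :
  {ae mu, forall t : R, (0 < f t)%R -> a < t%:E /\ (t < b)%R}.
Proof.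
have h0 := ae_density_eq_derive hf (cst 0%R) (cst 0%R).
have h1 := ae_density_eq_derive hf (cst 1%R) (cst 0%R).
(* For a = -oo, [fine a] is 0; discarding that extra point is harmless. *)
have h2 : {ae mu, forall t : R, t <> b /\ t <> fine a}.
  by apply: (@filterS2 _ _ aefilter) (ae_neq b) (ae_neq (fine a)) => t.
apply: (@filterS3 _ _ aefilter _ _ _ _ _ h0 h1 h2) => t {h0 h1 h2} f0 f1 [tb ta] ft.
split; rewrite ltNge; apply/negP.
- move=> tle; move: ft; rewrite f0 ?ltxx//.
  move: tle ta hab; have := fine_cdf_left_support.
  case: a => // r Fr tr ta _.
  have {}tr : (t < r)%R by rewrite lt_neqAle -lee_fin tr andbT; apply/eqP.
  near=> s; apply: Fr; rewrite lee_fin; apply/ltW; near: s; exact: lt_nbhsl.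
- move=> bt; move: ft; rewrite f1 ?ltxx//.
  have {}bt : (b < t)%R by rewrite lt_neqAle bt andbT; apply/eqP => /esym.
  near=> s; apply: fine_cdf_right_support; apply/ltW; near: s; exact: lt_nbhsr.
Unshelve. all: by end_near. Qed.

Lemma measurable_expR_hazard :
  measurable_fun [set: R] (fun t => expR t * phi t)%R.
Proof.
have [mf _ _] := hf.
apply: measurable_funM => //; apply: measurable_funM => //.
apply: measurable_funV_ge0; last by move=> t; exact: fine_cdf_ge0.
apply/measurable_EFinP; apply: (eq_measurable_fun (cdf X)) => [t _ /=|].
  by rewrite fine_cdfK.
exact: cdf_measurable.
Qed.

(** The logarithm of the function is -c (e^(-t) - e^(-b)), with derivative c e^(-t): this is the
    solution of F' = c e^(-t) F with value 1 at [b]. *)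
Lemma is_derive_gumbel (c x : R) : is_derive x (1 : R)%R
  (fun t => F0 t `^ c)%R (c * expR (- x) * F0 x `^ c)%R.
Proof.
rewrite /truncated_extreme_value_cdf.
under eq_fun do rewrite -expRM.
rewrite -expRM.
apply: is_derive_eq.
by rewrite /GRing.scale/=; ring.
Qed.

Lemma cdf_of_constant_hazard (c p : R) :
  {ae mu, forall t : R, a < t%:E < b%:E -> f t = (c * expR (- t) * F t)%R} ->
  (p < b)%R -> a <= p%:E -> F p = (F0 p `^ c)%R.
Proof.
move=> fE pb ap.
(* [h] is a continuous version of [f] on the support. Replacing [f] by [h] under the integral makes
   [F] differentiable at every point of (p, b), as the mean value theorem requires. *)
pose h t := (c * expR (- t) * F t)%R.
have ch : continuous h.
  move=> t; apply: cvgM; last exact: (fine_cdf_continuous hf).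
  apply: cvgM; first exact: cvg_cst.
  by apply: continuous_comp; [exact: continuousN|exact: continuous_expR].
have ih u v : mu.-integrable `[u, v] (EFin \o h).
  apply: continuous_compact_integrable; first exact: segment_compact.
  exact: continuous_subspaceT.
have FE x : (p <= x <= b)%R -> F x = (F p + \int[mu]_(t in `[p, x]) h t)%R.
  move=> /andP[px xb]; apply/eqP; rewrite addrC -subr_eq (fine_cdfB hf)//.
  apply/eqP.
  congr fine; apply: ae_eq_integral => //.
  - by apply: measurable_int (density_integrable hf _).
  - exact: measurable_int (ih _ _).
  apply: (@filterS3 _ _ aefilter _ _ _ _ _ fE (ae_neq p) (ae_neq b)).
  move=> t ft tp tb /=; rewrite in_itv/= => /andP[pt tx]; congr EFin.
  apply: ft; rewrite (le_lt_trans ap)/= ?lte_fin lt_neqAle ?pt ?(le_trans tx xb).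
    by rewrite andbT; apply/eqP.
  by rewrite andbT; apply/eqP => /esym.
have dF x : x \in `]p, b[%R -> is_derive x (1 : R)%R (fun t => F t) (h x).
  rewrite in_itv/= => /andP[px xb].
  have [dH HE] := continuous_FTC1_closed xb (ih p b) px (ch x).
  have Fnear : \forall y \near x,
      (F p + \int[mu]_(t in `[p, y]) h t)%R = F y.
    near=> y; rewrite -FE//; apply/andP; split; apply/ltW; near: y.
      exact: lt_nbhsr.
    exact: lt_nbhsl.
  have dS : is_derive x (1 : R)%R
      (fun y => F p + \int[mu]_(t in `[p, y]) h t)%R (h x).
    rewrite -[h x]add0r; apply: is_deriveD.
    by rewrite -HE derive1E; exact/derivableP.
  apply: DeriveDef.
    exact: near_eq_derivable Fnear _.
  by rewrite -(near_eq_derive _ Fnear) derive_val.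
(* Integrating factor of F' = c e^(-t) F: up to the constant factor exp(c e^(-b)), [G] is the
   quotient of [F] by the claimed solution. *)
pose G t := (F t * expR (expR (- t) * c))%R.
have dG x : x \in `]p, b[%R -> is_derive x (1 : R)%R G 0%R.
  move=> /dF dFx; apply: is_derive_eq.
  by rewrite /GRing.scale/= /h; ring.
have cG : continuous G.
  move=> t; apply: cvgM; first exact: (fine_cdf_continuous hf).
  apply: continuous_comp; last exact: continuous_expR.
  apply: cvgM; last exact: cvg_cst.
  by apply: continuous_comp; [exact: continuousN|exact: continuous_expR].
have [_ _] := MVT_segment (ltW pb) dG (continuous_subspaceT cG).
(* Constancy of [G] on [p, b] is used as G(b) = G(p), with F(b) = 1 fixing the constant. *)
move/eqP; rewrite mul0r subr_eq0 /G fine_cdf_right_support// mul1r => /eqP GE.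
rewrite /truncated_extreme_value_cdf -expRM opprB mulrBl expRB GE.
by rewrite mulfK// gt_eqF// expR_gt0.
Unshelve. all: by end_near. Qed.

End reversed_hazard.

(** * The inequality and its equality case *)

Theorem theorem2p4 (d : measure_display) (T : measurableType d) (R : realType)
    (P : probability T R) (X : {RV P >-> R}) (f : R -> R)
    (a : \bar R) (b : R)
    (hf : has_density X f)
    (hab : a < b%:E)
    (hsupp : has_support X f a b%:E)
    (hX2 : 'E_P[fun w => (X w ^+ 2)%R] < +oo)
    (hE : 'E_P[fun w => (expR (X w) * reversed_hazard_rate X f (X w))%R] < +oo)
    (hEinv : 'E_P[fun w =>
        (1 / (expR (X w) * reversed_hazard_rate X f (X w)))%R] < +oo) :
  ('E_P[fun w => (expR (X w) * reversed_hazard_rate X f (X w))%R])^-1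
    <= 'E_P[fun w => (1 / (expR (X w) * reversed_hazard_rate X f (X w)))%R]
  /\
  ('E_P[fun w => (1 / (expR (X w) * reversed_hazard_rate X f (X w)))%R]
     = ('E_P[fun w => (expR (X w) * reversed_hazard_rate X f (X w))%R])^-1
   <->
   exists2 alpha : R, (0 < alpha)%R &
     forall x : R, (x <= b)%R ->
       cdf X x = ((truncated_extreme_value_cdf b x) `^ alpha)%:E).
Proof.
pose g t := (expR t * reversed_hazard_rate X f t)%R.
pose Y w := g (X w).
rewrite unlock in hE hEinv *.
have VE : (fun w => (1 / (expR (X w) * reversed_hazard_rate X f (X w)))%:E)
    = (fun w => (Y w)^-1%:E).
  by apply/funext => w; rewrite div1r.
rewrite {}VE in hEinv *.
have mg : measurable_fun [set: R] g := measurable_expR_hazard hf.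
have mY : measurable_fun [set: T] Y.
  by apply: (measurableT_comp mg); exact: measurable_funP.
have g_ge0 t : (0 <= g t)%R.
  have [_ f_ge0 _] := hf.
  by rewrite mulr_ge0// ?expR_ge0// divr_ge0// fine_cdf_ge0.
have Y_ge0 w : (0 <= Y w)%R by exact: g_ge0.
have fsupp := ae_density_gt0_support hf hab hsupp.
have Y_gt0 : {ae P, forall w, (0 < Y w)%R}.
  apply: (ae_comp_density hf (Q := fun t => (0 < g t)%R)).
  apply: (@filterS _ _ (ae_filter_ringOfSetsType _)) fsupp => t h ft.
  have [ta _] := h ft.
  by rewrite mulr_gt0 ?expR_gt0// divr_gt0// (fine_cdf_gt0_support hsupp).
split; first exact: inv_integral_le.
split=> [/(inv_integral_eq_cst mY Y_ge0 Y_gt0 hE)[c c_gt0 Yc]|].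
  exists c => //.
  have fE : {ae lebesgue_measure, forall t : R, a < t%:E < b%:E ->
      f t = (c * expR (- t) * fine (cdf X t))%R}.
    have [_ _ f_gt0] := hsupp.
    apply: (@filterS2 _ _ (ae_filter_ringOfSetsType _)) f_gt0
      (ae_density_comp hf mg Yc) => t ft gt tab.
    rewrite -(gt (ft tab)) /g /reversed_hazard_rate expRN.
    have Ft : fine (cdf X t) != 0%R.
      by case/andP: tab => ta _; rewrite gt_eqF// (fine_cdf_gt0_support hsupp).
    by field; rewrite Ft gt_eqF// expR_gt0.
  have FE := cdf_of_constant_hazard hf hsupp fE.
  move=> x xb; rewrite -fine_cdfK; congr EFin.
  (* The differential equation covers x < b only; at x = b both sides are 1. *)
  have [xltb|bx] := ltP x b; last first.
    have -> : x = b by apply/le_anti/andP.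
    rewrite (fine_cdf_right_support hf hsupp)//.
    by rewrite /truncated_extreme_value_cdf subrr oppr0 expR0 powR1.
  (* For finite [a], the formula at [a] itself would give F(a) > 0, whereas F(a) = 0. *)
  suff aNy : a = -oo by apply: FE => //; rewrite aNy leNye.
  have := hab; case aE : a => [r||]//; rewrite lte_fin => rb.
  have := FE r rb; rewrite aE lexx => /(_ isT).
  rewrite (fine_cdf_left_support hf hsupp) ?aE// => /esym/eqP.
  by rewrite gt_eqF// powR_gt0// expR_gt0.
move=> [alpha alpha_gt0 FE].
have gE : {ae lebesgue_measure, forall t : R, (0 < f t)%R -> g t = alpha}.
  have fE := ae_density_eq_derive hf
    (fun t => truncated_extreme_value_cdf b t `^ alpha)%R
    (fun t => alpha * expR (- t) * truncated_extreme_value_cdf b t `^ alpha)%R.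
  apply: (@filterS2 _ _ (ae_filter_ringOfSetsType _)) fE fsupp => t ft h ft0.
  have [ta tb] := h ft0.
  (* Since t < b strictly, the formula for [F] holds on a whole neighbourhood of t and can be
     differentiated. *)
  have Fnear : \forall s \near t, fine (cdf X s)
      = (truncated_extreme_value_cdf b s `^ alpha)%R.
    near=> s; rewrite FE//=; apply/ltW; near: s; exact: lt_nbhsl.
  rewrite /g /reversed_hazard_rate (ft Fnear (is_derive_gumbel b alpha t)).
  rewrite FE ?(ltW tb)//= expRN.
  by field; rewrite !gt_eqF ?powR_gt0 ?expR_gt0.
have Yalpha : {ae P, forall w, Y w = alpha}.
  exact: (ae_comp_density hf (Q := fun t => g t = alpha)).
(* The two expectations are now [alpha] and its inverse. *)
rewrite (ae_cst_integral mY Yalpha).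
rewrite (ae_cst_integral (measurable_funV_ge0 mY Y_ge0) (c := alpha^-1)).
  by rewrite inver gt_eqF.
by apply: filterS Yalpha => w ->.
Unshelve. all: by end_near. Qed.
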